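(* The following inequalities do not cut off any feasible solution of the mixed integer program $\mathcal{F}$ associated with an STOP instance: for every feasible solution $(\bar x,\bar y,\bar f,\bar\varphi)$ of $\mathcal{F}$, every conflict clique $\sigma\in\Sigma$ and every $V\subseteq N\setminus\{s\}$ with $\sigma\subseteq V$, $$\sum_{e\in\delta^-(V)}\bar x_e\;\geq\;\sum_{i\in\sigma}\bar y_i .$$
   Context: STOP instance: a tuple $\langle G,S,P,s,t,p,d,M,T\rangle$ where $G=(N,A)$ is a (not necessarily complete) digraph; $s,t\in N$, $s\neq t$, are the origin and destination; $S,P\subseteq N\setminus\{s,t\}$ are the mandatory and profitable vertices, with $N=S\cup P\cup\{s,t\}$ and $S\cap P=\emptyset$; $p_i\in\mathbb{Z}^+$ is a reward for each $i\in P$; $d_{ij}\in\mathbb{R}^+$ is a (non-negative) traverse time for each arc $(i,j)\in A$; $M$ is a fleet of homogeneous vehicles, $m=|M|$; $T$ is the time limit of each route. Notation: for $V\subset N$, $\delta^+(V)=\{(i,j)\in A: i\in V, j\in N\setminus V\}$ and $\delta^-(V)=\{(i,j)\in A: i\in N\setminus V, j\in V\}$; for $i\in N$, $\delta^+(i)=\{j\in N:(i,j)\in A\}$ and $\delta^-(i)=\{j\in N:(j,i)\in A\}$. $R_{ij}$ is the minimum total traverse time of a path from $i$ to $j$ in $G$ ($R_{ii}=0$; $R_{ij}=\infty$ if no path exists; a constraint below involving an infinite $R$-value is read as forcing the corresponding $x_{ij}$, and $f_{ij}$ in the case of an upper bound on $f_{ij}$, to be $0$). The formulation $\mathcal{F}$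 has variables $x_{ij},f_{ij}$ ($(i,j)\in A$), $y_i$ ($i\in N$) and $\varphi$; it maximizes $\sum_{i\in P}p_iy_i$ subject to: - $y_i=1$ for all $i\in S\cup\{s,t\}$; - $\sum_{j\in\delta^+(i)}x_{ij}=y_i$ for all $i\in S\cup P$; - $\sum_{j\in\delta^+(s)}x_{sj}=\sum_{i\in\delta^-(t)}x_{it}=m-\varphi$; - $\sum_{i\in\delta^-(s)}x_{is}=\sum_{j\in\delta^+(t)}x_{tj}=0$; - $\sum_{j\in\delta^+(i)}x_{ij}-\sum_{j\in\delta^-(i)}x_{ji}=0$ for all $i\in S\cup P$; - $f_{sj}=(T-d_{sj})x_{sj}$ for all $j\in\delta^+(s)$; - $\sum_{j\in\delta^-(i)}f_{ji}-\sum_{j\in\delta^+(i)}f_{ij}=\sum_{j\in\delta^+(i)}d_{ij}x_{ij}$ for all $i\in S\cup P$; - $f_{ij}\leq(T-R_{si}-d_{ij})x_{ij}$ for all $(i,j)\in A$ with $i\neq s$; - $f_{ij}\geq R_{jt}x_{ij}$ for all $(i,j)\in A$; - $x_{ij}\in\{0,1\}$ and $f_{ij}\geq0$ for all $(i,j)\in A$; $y_i\in\{0,1\}$ for all $i\in N$; $0\leq\varphi\leq m$. Conflict cliques: $\mathcal{K}$ is the set of unordered pairs $\{i,j\}$ of distinct vertices of $N\setminus\{s,t\}$ such that any route from $s$ to $t$ in $G$ that visits $i$ and $j$ (in any order) has a total traverse time exceeding $T$. The conflict graph is the undirected graph $G_c=(N\setminus\{s,t\},\mathcal{K})$, and $\Sigma$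 is the set of all cliques of $G_c$ (not necessarily maximal, including single vertices), called conflict cliques.
   Formalization: The formal theorem additionally assumes that every directed cycle of G avoiding s and t has positive total traverse time (implied by all d_ij > 0); with zero times allowed the claim fails, since a zero-time cycle disconnected from s can be feasible. *)

(* Defs.v *)
From HB Require Import structures.
From mathcomp Require Import all_boot all_order all_algebra.
From mathcomp Require Import classical_sets reals constructive_ereal ereal.

Set Implicit Arguments.
Unset Strict Implicit.
Unset Printing Implicit Defensive.

Import Order.TTheory GRing.Theory Num.Theory.

Local Open Scope ring_scope.

(* The digraph need not be complete, and loops are not excluded. *)
Record stop_instance (R : realType) := StopInstance {
  vertex : finType;
  arcs : {set vertex * vertex};
  origin : vertex;
  destination : vertex;
  mandatory : {set vertex};
  profitable : {set vertex};
  reward : vertex -> int;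
  traverse_time : vertex * vertex -> R;
  fleet : finType;
  time_limit : R;
  origin_neq_destination : origin != destination;
  mandatory_profitable_disjoint : [disjoint mandatory & profitable];
  mandatory_profitable_cover :
    mandatory :|: profitable = ~: [set origin; destination];
  reward_ge0 : forall i, i \in profitable -> 0 <= reward i;
  traverse_time_ge0 : forall e, e \in arcs -> 0 <= traverse_time e
}.

Arguments reward {R} _ _.
Arguments traverse_time {R} _ _.

Section Stop.
Variables (R : realType) (I : stop_instance R).

Local Notation N := (vertex I).
Local Notation A := (arcs I).
Local Notation s := (origin I).
Local Notation t := (destination I).
Local Notation S := (mandatory I).
Local Notation P := (profitable I).
Local Notation d := (traverse_time I).
Local Notation T := (time_limit I).

Implicit Types (i j : N) (q : seq N) (V sigma : {set N}).

Definition is_arc : rel N := fun i j => (i, j) \in A.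

Definition out_nbr i : {set N} := [set j | (i, j) \in A].
Definition in_nbr i : {set N} := [set j | (j, i) \in A].

(* The arcs entering V, that is, delta^-(V). *)
Definition in_cut V : {set N * N} := [set e in A | (e.1 \notin V) && (e.2 \in V)].

(* Total time of the walk i :: q; the zip is the list of its successive arcs. *)
Definition walk_time i q : R := \sum_(e <- zip (i :: q) q) d e.

(* i :: q is an elementary path from i to j. *)
Definition is_path i j q : bool :=
  [&& path is_arc i q, last i q == j & uniq (i :: q)].

(* The minimum time R_ij of a path. The paths are elementary, hence finitely
   many, so the infimum is a minimum; it is +oo when there is no path. *)
Definition min_time i j : \bar R :=
  ereal_inf [set (walk_time i q)%:E | q in [set q | is_path i j q]]%classic.

(* feas_flow_upper and feas_flow_lower live in \bar R, where 0 * +oo = 0: an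
   infinite min_time makes them fail for x e = 1 and, for x e = 0, leaves
   f e <= 0 and 0 <= f e respectively.
   The values of x and f outside the arcs are never constrained nor used. *)
Record feasible (x : N * N -> R) (y : N -> R) (f : N * N -> R) (phi : R) : Prop
    := Feasible {
  feas_mandatory : forall i, i \in S :|: [set s; t] -> y i = 1;
  feas_visit : forall i, i \in S :|: P ->
    \sum_(j in out_nbr i) x (i, j) = y i;
  feas_origin_out : \sum_(j in out_nbr s) x (s, j) = #|fleet I|%:R - phi;
  feas_destination_in : \sum_(i in in_nbr t) x (i, t) = #|fleet I|%:R - phi;
  feas_origin_in : \sum_(i in in_nbr s) x (i, s) = 0;
  feas_destination_out : \sum_(j in out_nbr t) x (t, j) = 0;
  feas_conservation : forall i, i \in S :|: P ->
    \sum_(j in out_nbr i) x (i, j) - \sum_(j in in_nbr i) x (j, i) = 0;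
  feas_flow_origin : forall j, j \in out_nbr s ->
    f (s, j) = (T - d (s, j)) * x (s, j);
  feas_flow : forall i, i \in S :|: P ->
    \sum_(j in in_nbr i) f (j, i) - \sum_(j in out_nbr i) f (i, j) =
    \sum_(j in out_nbr i) d (i, j) * x (i, j);
  feas_flow_upper : forall i j, (i, j) \in A -> i != s ->
    ((f (i, j))%:E <=
      (T%:E - min_time s i - (d (i, j))%:E) * (x (i, j))%:E)%E;
  feas_flow_lower : forall i j, (i, j) \in A ->
    (min_time j t * (x (i, j))%:E <= (f (i, j))%:E)%E;
  feas_x_binary : forall e, e \in A -> x e = 0 \/ x e = 1;
  feas_f_ge0 : forall e, e \in A -> 0 <= f e;
  feas_y_binary : forall i, y i = 0 \/ y i = 1;
  feas_phi : 0 <= phi <= #|fleet I|%:R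
}.

(* To be maximized over the feasible (x, y, f, phi). *)
Definition objective (y : N -> R) : R := \sum_(i in P) (reward I i)%:~R * y i.

(* The edges of the conflict graph. A route is an elementary path from s to t,
   and i, j conflict in particular when no route visits both. *)
Definition conflict i j : Prop :=
  [/\ i != j, i \notin [set s; t], j \notin [set s; t] &
   forall q, is_path s t q -> i \in s :: q -> j \in s :: q ->
     T < walk_time s q].

Definition conflict_clique sigma : Prop :=
  sigma \subset ~: [set s; t] /\
  {in sigma &, forall i j, i != j -> conflict i j}.

(* Every directed cycle i, q_1, .., q_k, i of G that avoids s and t (a loop when
   q is empty) takes positive time. This holds as soon as the traverse times are
   positive. It cannot be dropped: with zero times on i -> j -> i, feasible
   allows a circulation on these two arcs that is disconnected from s. *)
Definition no_zero_time_cycle : Prop :=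
  forall i q, ucycle is_arc (i :: q) -> s \notin i :: q -> t \notin i :: q ->
    0 < walk_time i (rcons q i).

End Stop.

(* Main.v *)
Require Import Defs.
From mathcomp Require Import all_boot all_order all_algebra.
From mathcomp Require Import reals constructive_ereal.

Set Implicit Arguments.
Unset Strict Implicit.
Unset Printing Implicit Defensive.

Import Order.TTheory GRing.Theory Num.Theory.
Local Open Scope ring_scope.

(** Let G_x be the graph of the arcs with x = 1. At a vertex other than s and t
it has at most one entering and one leaving arc, and the flow entering the
vertex serves as a potential: it decreases by exactly the traverse time along
each arc. Hence a cycle of G_x would have time 0, so G_x is acyclic, every
visited vertex lies on a path of G_x from s to t, and such a path takes time at
most T. For a visited i in sigma the path from s to i enters V through some arc
e_i. If e_i = e_j with i <> j, then i and j lie on one path leaving the head of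
e_i, hence on one route of time at most T, against the conflict of i and j. So
i |-> e_i is injective, and the number of visited vertices of sigma is at most
that of the arcs of G_x entering V. *)

(** * Sums of variables with values in {0, 1} *)

Section BinarySums.
Variables (R : numDomainType) (J : finType) (D : {set J}) (F : J -> R).
Hypothesis F01 : {in D, forall j, F j = 0 \/ F j = 1}.

Lemma binary_ge0 j : j \in D -> 0 <= F j.
Proof. by move=> /F01[] ->. Qed.

Lemma binary_sum0 : \sum_(j in D) F j = 0 -> {in D, forall j, F j = 0}.
Proof.
move=> sum0 j jD; apply/eqP; move/eqP: sum0.
by rewrite psumr_eq0 => [/allP/(_ j (mem_index_enum _))|];
  [rewrite jD | exact: binary_ge0].
Qed.

Lemma binary_sum1 : \sum_(j in D) F j = 1 -> exists2 j, j \in D & F j = 1.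
Proof.
move=> sum1; have [/existsP[j /andP[jD /eqP Fj]]|] :=
  boolP [exists j, (j \in D) && (F j == 1)]; first by exists j.
rewrite negb_exists => /forallP noj; move: sum1; rewrite big1 => [/eqP|j jD].
  by rewrite eq_sym oner_eq0.
by case: (F01 jD) => // Fj; have := noj j; rewrite jD Fj eqxx.
Qed.

Lemma binary_sum_inj j k : \sum_(i in D) F i <= 1 -> j \in D -> k \in D ->
  F j = 1 -> F k = 1 -> j = k.
Proof.
move=> sum1 jD kD Fj Fk; apply/eqP/negPn/negP => njk; move: sum1.
rewrite (bigD1 j) //= Fj gerDl (bigD1 k) ?kD 1?eq_sym //= Fk => le0.
have : 1 <= (0 : R).
  apply: le_trans le0; rewrite lerDl sumr_ge0 // => i /andP[/andP[iD _] _].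
  exact: binary_ge0.
by rewrite ler10.
Qed.

Lemma binary_sum_card : \sum_(j in D) F j = #|[set j in D | F j == 1]|%:R.
Proof.
rewrite (bigID (fun j => F j == 1)) /= addrC big1 ?add0r; last first.
  by move=> j /andP[/F01[//|->]]; rewrite eqxx.
by rewrite -sum1_card natr_sum; apply: eq_big => j;
  rewrite ?inE // => /andP[_ /eqP].
Qed.

End BinarySums.

(** * Finite acyclic relations *)

Section AcyclicRelations.
Variables (U : finType) (e : rel U).

(** A path from [j] back to [i] can be shortened to an elementary one, which the arc [e i j] closes
    into an elementary cycle. *)
Lemma ucycle_free_acyclic :
    (forall i q, ~ ucycle e (i :: q)) ->
  forall i j, e i j -> ~~ connect e j i.
Proof.
move=> noc i j eij; apply/negP => /connectP[p pjp ip].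
move: ip; case/shortenP: pjp => q pjq uq _ iq.
by apply: (noc j q); rewrite /ucycle uq /= rcons_path pjq -iq eij.
Qed.

Hypothesis acyclic : forall i j, e i j -> ~~ connect e j i.

Lemma acyclic_path_uniq i q : path e i q -> uniq (i :: q).
Proof.
elim: q i => [//|j q IH] i /andP[eij pjq].
rewrite cons_uniq (IH _ pjq) andbT; apply/negP => iq.
by have := acyclic eij; rewrite (path_connect pjq iq).
Qed.

(** Induction on the number of vertices reachable from [i]: it drops strictly along an arc from [i]
    to [j], since acyclicity makes [i] unreachable from [j]. *)
Lemma acyclic_connect (Q : pred U) z :
    (forall i, Q i -> i != z -> exists2 j, e i j & (j == z) || Q j) ->
  forall i, Q i -> connect e i z.
Proof.
move=> step i; have [n] := ubnP #|[set k | connect e i k]|.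
elim: n i => // n IH i le_n Qi; have [-> //|niz] := eqVneq i z.
have [j eij /predU1P[<-|Qj]] := step i Qi niz; first exact: connect1.
apply: connect_trans (connect1 eij) (IH j _ Qj).
apply: leq_trans (_ : #|_| < #|[set k | connect e i k]|)%N le_n.
apply/proper_card/properP; split.
  by apply/subsetP => k; rewrite !inE; apply: connect_trans (connect1 eij).
by exists i; rewrite inE // acyclic.
Qed.

End AcyclicRelations.

(** * Paths crossing a cut, and paths with unique successors *)

Section Connect.
Variables (U : finType) (e : rel U).

Lemma connect_crossing (V : {set U}) a i :
    connect e a i -> a \notin V -> i \in V ->
  exists b c, [/\ e b c, b \notin V, c \in V & connect e c i].
Proof.
move=> /connectP[q pq ->] {i}; elim: q a pq => [|c q IH] a /= => [_ /negP //|].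
move=> /andP[eac pq] aV iV; have [cV|/IH] := boolP (c \in V); last exact.
by exists a, c; split=> //; apply/connectP; exists q.
Qed.

(** Two paths from [a] agree until the shorter one ends. The predicate [Q] leaves room for a vertex
    with several successors, here the origin. *)
Lemma connect_functional (Q : pred U) a i j :
    (forall b c d, Q b -> e b c -> e b d -> c = d) ->
    (forall b c, e b c -> Q c) ->
  Q a -> connect e a i -> connect e a j -> connect e i j || connect e j i.
Proof.
move=> func QS Qa /connectP[q pq ->] {i}; elim: q a Qa pq => [|c q IH] a Qa /=.
  by move=> _ ->.
move=> /andP[eac pq] /connectP[[|d r] /= pr jr].
  by apply/orP; right; rewrite jr; apply/connectP; exists (c :: q);
    rewrite //= eac.
case/andP: pr => ead pr; apply: (IH c (QS _ _ eac) pq).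
by rewrite (func _ _ _ Qa eac ead); apply/connectP; exists r.
Qed.

End Connect.

(** * The arcs used by a feasible solution *)

Section Solution.
Variables (R : realType) (I : stop_instance R).
Variables (x : vertex I * vertex I -> R) (y : vertex I -> R).
Variables (f : vertex I * vertex I -> R) (phi : R).
Hypothesis hfeas : feasible x y f phi.

Local Notation s := (origin I).
Local Notation t := (destination I).
Local Notation d := (traverse_time I).
Local Notation T := (time_limit I).

Definition used : rel (vertex I) := fun i j => is_arc i j && (x (i, j) == 1).

(** At an inner vertex on a route from [s], this is the time left on arrival. *)
Definition inflow (i : vertex I) : R := \sum_(j in in_nbr i) f (j, i).

Lemma walk_time_nil (i : vertex I) : walk_time i [::] = 0.
Proof. by rewrite /walk_time big_nil. Qed.

Lemma walk_time_cons (i j : vertex I) q :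
  walk_time i (j :: q) = d (i, j) + walk_time j q.
Proof. by rewrite /walk_time big_cons. Qed.

Lemma innerP (i : vertex I) :
  reflect (i != s /\ i != t) (i \in mandatory I :|: profitable I).
Proof.
by rewrite mandatory_profitable_cover !inE negb_or; apply: andP.
Qed.

Lemma used_arc i j : used i j -> (i, j) \in arcs I.
Proof. by case/andP. Qed.

Lemma out_nbr_binary (i : vertex I) :
  {in out_nbr i, forall j, x (i, j) = 0 \/ x (i, j) = 1}.
Proof. by move=> j; rewrite inE => /(feas_x_binary hfeas). Qed.

Lemma in_nbr_binary (i : vertex I) :
  {in in_nbr i, forall j, x (j, i) = 0 \/ x (j, i) = 1}.
Proof. by move=> j; rewrite inE => /(feas_x_binary hfeas). Qed.

Lemma used_neq_origin i j : used i j -> j != s.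
Proof.
move=> /andP[ij /eqP xij]; apply/eqP => js; move: ij xij; rewrite js => ij.
rewrite (binary_sum0 (@in_nbr_binary s) (feas_origin_in hfeas)) ?inE //.
by move/esym/eqP; rewrite oner_eq0.
Qed.

Lemma used_neq_destination i j : used i j -> i != t.
Proof.
move=> /andP[ij /eqP xij]; apply/eqP => it; move: ij xij; rewrite it => ij.
rewrite (binary_sum0 (@out_nbr_binary t) (feas_destination_out hfeas)) ?inE //.
by move/esym/eqP; rewrite oner_eq0.
Qed.

Lemma sum_out_le1 (i : vertex I) :
  i != s -> \sum_(j in out_nbr i) x (i, j) <= 1.
Proof.
move=> is_; have [->|it] := eqVneq i t.
  by rewrite (feas_destination_out hfeas) ler01.
rewrite (feas_visit hfeas); last exact/innerP.
by case: (feas_y_binary hfeas i) => ->.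
Qed.

Lemma sum_in i : i \in mandatory I :|: profitable I ->
  \sum_(j in in_nbr i) x (j, i) = y i.
Proof.
move=> ii; have /eqP := feas_conservation hfeas ii.
by rewrite subr_eq0 (feas_visit hfeas) // => /eqP.
Qed.

Lemma used_out_inj i j k : i != s -> used i j -> used i k -> j = k.
Proof.
move=> is_ /andP[ij /eqP xij] /andP[ik /eqP xik].
by apply: (binary_sum_inj (@out_nbr_binary i) (sum_out_le1 is_)); rewrite ?inE.
Qed.

Lemma used_in_inj i j k : k != t -> used i k -> used j k -> i = j.
Proof.
move=> kt uik ujk; have ks := used_neq_origin uik.
case/andP: uik ujk => ik /eqP xik /andP[jk /eqP xjk].
apply: (binary_sum_inj (@in_nbr_binary k)); rewrite ?inE //.
rewrite sum_in; last exact/innerP.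
by case: (feas_y_binary hfeas k) => ->.
Qed.

(** * The flow as a potential, and the time of a route *)

Lemma unused_flow i j : (i, j) \in arcs I -> ~~ used i j -> f (i, j) = 0.
Proof.
move=> ij; rewrite /used [is_arc i j]ij /= => nx.
have xij : x (i, j) = 0.
  by case: (feas_x_binary hfeas ij) nx => // ->; rewrite eqxx.
have [is_|is_] := eqVneq i s.
  rewrite is_ in ij xij *.
  by rewrite (feas_flow_origin hfeas) ?inE // xij mulr0.
apply/eqP; rewrite eq_le (feas_f_ge0 hfeas ij) andbT.
(* The bound becomes 0 even if [min_time s i] is infinite, as [mule0] holds for every extended
   real. *)
by have := feas_flow_upper hfeas ij is_; rewrite xij mule0 lee_fin.
Qed.

Lemma inflow_used i j : j != t -> used i j -> inflow j = f (i, j).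
Proof.
move=> jt uij; rewrite /inflow (bigD1 i) ?inE ?used_arc //=.
rewrite big1 ?addr0 // => k; rewrite inE => /andP[kj nki].
by apply: unused_flow => //; apply: contra nki => /(used_in_inj jt uij) ->.
Qed.

Lemma inflow_drop i j : i != s -> used i j -> inflow i = d (i, j) + f (i, j).
Proof.
move=> is_ uij; have it := used_neq_destination uij.
have ii : i \in mandatory I :|: profitable I by exact/innerP.
have ij : j \in out_nbr i by rewrite inE used_arc.
have /eqP := feas_flow hfeas ii; rewrite subr_eq => /eqP; rewrite /inflow => ->.
have noused k : (k \in out_nbr i) && (k != j) ->
    ((i, k) \in arcs I) /\ ~~ used i k.
  rewrite inE => /andP[ik nkj]; split=> //.
  by apply: contra nkj => /(used_out_inj is_ uij) ->.
rewrite !(bigD1 j ij) /= !big1 => [|k /noused[]|k /noused[ik]].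
- by case/andP: uij => _ /eqP ->; rewrite mulr1 !addr0.
- exact: unused_flow.
rewrite /used [is_arc i k]ik /= => nx.
by case: (feas_x_binary hfeas ik) nx => ->; rewrite ?mulr0 // eqxx.
Qed.

(** The drops of the potential telescope. The end [t] is excluded because several routes may enter
    it, so its inflow need not be the flow of a single arc. *)
Lemma inflow_walk i q : i != s -> last i q != t -> path used i q ->
  walk_time i q = inflow i - inflow (last i q).
Proof.
elim: q i => [|j q IH] i is_ /= lt; first by rewrite walk_time_nil subrr.
move=> /andP[uij pq]; have js := used_neq_origin uij.
have jt : j != t by case: q pq lt {IH} => //= k q /andP[/used_neq_destination].
rewrite walk_time_cons IH // (inflow_used jt uij) (inflow_drop is_ uij).
by rewrite addrA.
Qed.

(** The potential pays for every arc up to [t]; what remains is the flow on the last arc, which is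
    nonnegative. *)
Lemma walk_time_le_inflow i q : i != s -> i != t -> last i q = t ->
  path used i q -> walk_time i q <= inflow i.
Proof.
elim: q i => [|j q IH] i is_ it /=; first by move=> it'; rewrite it' eqxx in it.
move=> lq /andP[uij pq]; rewrite walk_time_cons (inflow_drop is_ uij) lerD2l.
have [jt|jt] := eqVneq j t; last first.
  by rewrite -(inflow_used jt uij) IH // (used_neq_origin uij).
(* No used arc leaves [t], so the walk stops there. *)
case: q pq {IH lq} => [|k q] /=.
  by rewrite walk_time_nil (feas_f_ge0 hfeas) // used_arc.
by case/andP => /used_neq_destination; rewrite jt eqxx.
Qed.

Lemma used_path_is_arc i q : path used i q -> path (@is_arc R I) i q.
Proof. by apply: sub_path => u v /andP[]. Qed.

(** The first arc leaves a flow of [T - d (s, j)], which bounds the time of the rest of the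
    route. *)
Lemma route_time q : path used s q -> last s q = t -> walk_time s q <= T.
Proof.
case: q => [_ /= st|j q /= /andP[usj pq] lq].
  by have := origin_neq_destination I; rewrite st eqxx.
have sj := used_arc usj.
have fsj : f (s, j) = T - d (s, j).
  rewrite (feas_flow_origin hfeas) ?inE //.
  by case/andP: usj => _ /eqP ->; rewrite mulr1.
rewrite walk_time_cons -lerBrDl -fsj.
have [jt|jt] := eqVneq j t; last first.
  by rewrite -(inflow_used jt usj) walk_time_le_inflow // (used_neq_origin usj).
case: q pq {lq} => [|k q] /=.
  by rewrite walk_time_nil (feas_f_ge0 hfeas).
by case/andP => /used_neq_destination; rewrite jt eqxx.
Qed.

(** * Acyclicity, and routes through the visited vertices *)

Hypothesis hcycle : no_zero_time_cycle I.

Lemma used_acyclic i j : used i j -> ~~ connect used j i.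
Proof.
move: i j; apply: ucycle_free_acyclic => i q /andP[pq uq].
(* Each vertex of a cycle has a used arc entering it and one leaving it. *)
have ns j : j \in i :: q -> (j != s) && (j != t).
  move=> jq; have := next_cycle pq jq; have := prev_cycle pq jq.
  by move=> /used_neq_origin -> /used_neq_destination ->.
have sq : s \notin i :: q by apply/negP => /ns; rewrite eqxx.
have tq : t \notin i :: q by apply/negP => /ns; rewrite eqxx andbF.
have /andP[is_ it] : (i != s) && (i != t) by apply: ns; rewrite mem_head.
have uc : ucycle (@is_arc R I) (i :: q).
  by rewrite /ucycle uq andbT; apply: used_path_is_arc.
have := hcycle uc sq tq.
(* The closed walk ends where it starts, so its potential difference, hence its time, is 0. *)
by rewrite inflow_walk ?last_rcons // subrr ltxx.
Qed.

Lemma visited_pred i : i \in mandatory I :|: profitable I -> y i = 1 ->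
  exists2 j, used j i & (j == s) ||
    (j \in mandatory I :|: profitable I) && (y j == 1).
Proof.
move=> ii yi; have := sum_in ii; rewrite yi.
case/(binary_sum1 (@in_nbr_binary i)) => j; rewrite inE => ji xji.
have uji : used j i by rewrite /used [is_arc j i]ji xji eqxx.
exists j => //; have [//|js /=] := eqVneq j s.
have jj : j \in mandatory I :|: profitable I.
  by apply/innerP; rewrite (used_neq_destination uji).
rewrite jj /=; case: (feas_y_binary hfeas j) => [yj|-> //].
(* An unvisited [j] would have no used leaving arc, contrary to [x (j, i) = 1]. *)
have := feas_visit hfeas jj; rewrite yj => /(binary_sum0 (@out_nbr_binary j)).
by move=> /(_ i); rewrite inE xji => /(_ ji) /eqP; rewrite oner_eq0.
Qed.

Lemma visited_succ i : i \in mandatory I :|: profitable I -> y i = 1 ->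
  exists2 j, used i j & (j == t) ||
    (j \in mandatory I :|: profitable I) && (y j == 1).
Proof.
move=> ii yi; have := feas_visit hfeas ii; rewrite yi.
case/(binary_sum1 (@out_nbr_binary i)) => j; rewrite inE => ij xij.
have uij : used i j by rewrite /used [is_arc i j]ij xij eqxx.
exists j => //; have [//|jt /=] := eqVneq j t.
have jj : j \in mandatory I :|: profitable I.
  by apply/innerP; rewrite (used_neq_origin uij).
rewrite jj /=; case: (feas_y_binary hfeas j) => [yj|-> //].
have := sum_in jj; rewrite yj => /(binary_sum0 (@in_nbr_binary j)).
by move=> /(_ i); rewrite inE xij => /(_ ij) /eqP; rewrite oner_eq0.
Qed.

Lemma visited_to i : i \in mandatory I :|: profitable I -> y i = 1 ->
  connect used i t.
Proof.
move=> ii yi.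
apply: (acyclic_connect used_acyclic
  (Q := fun j => (j \in mandatory I :|: profitable I) && (y j == 1))).
  by move=> j /andP[jj /eqP yj] _; apply: visited_succ.
by rewrite ii yi eqxx.
Qed.

Lemma visited_from i : i \in mandatory I :|: profitable I -> y i = 1 ->
  connect used s i.
Proof.
move=> ii yi.
(* Following predecessors back to [s] is following successors in the reversed relation, which is
   acyclic too. *)
have -> : connect used s i = connect (fun j k => used k j) i s.
  by rewrite (connect_rev used).
apply: (acyclic_connect _
  (Q := fun j => (j \in mandatory I :|: profitable I) && (y j == 1))).
- by move=> j k ukj; rewrite (connect_rev used) /= used_acyclic.
- by move=> j /andP[jj /eqP yj] _; apply: visited_pred.
by rewrite ii yi eqxx.
Qed.

(** Otherwise paths from [s] to [i], from [i] to [j] and from [j] to [t] concatenate to a route of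
    time at most [T]; acyclicity makes it elementary. *)
Lemma conflict_not_connect i j :
  conflict i j -> y i = 1 -> y j = 1 -> ~~ connect used i j.
Proof.
case=> _; rewrite -!in_setC -!mandatory_profitable_cover => ii jj hij yi yj.
apply/negP => /connectP[q2 p2 j2].
have /connectP[q1 p1 i1] := visited_from ii yi.
have /connectP[q3 p3 t3] := visited_to jj yj.
have pq : path used s (q1 ++ q2 ++ q3).
  by rewrite !cat_path p1 -i1 p2 -j2.
have lq : last s (q1 ++ q2 ++ q3) = t by rewrite !last_cat -i1 -j2.
have := route_time pq lq; rewrite leNgt => /negP; apply; apply: hij.
- rewrite /is_path used_path_is_arc // lq eqxx /=.
  exact: (acyclic_path_uniq used_acyclic pq).
- by rewrite -cat_cons mem_cat i1 mem_last.
by rewrite catA -cat_cons mem_cat j2 i1 -last_cat mem_last.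
Qed.

(** * Counting the used arcs that enter V *)

Lemma clique_le_cut (sigma V : {set vertex I}) :
    conflict_clique sigma -> V \subset ~: [set s] -> sigma \subset V ->
  \sum_(i in sigma) y i <= \sum_(e in in_cut V) x e.
Proof.
move=> [sub_inner clique] sV sigmaV.
have inner i : i \in sigma -> i \in mandatory I :|: profitable I.
  by move=> /(subsetP sub_inner); rewrite mandatory_profitable_cover.
have snV : s \notin V by apply/negP => /(subsetP sV); rewrite !inE eqxx.
pose D := [set i in sigma | y i == 1].
pose C := [set e in in_cut V | x e == 1].
pose enters i e := (e \in C) && connect used e.2 i.
have entry i : i \in D -> exists e, enters i e.
  rewrite inE => /andP[si /eqP yi].
  have iV := subsetP sigmaV _ si.
  have := connect_crossing (visited_from (inner _ si) yi) snV iV.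
  case=> a [b [/andP[ab xab] aV bV bi]]; exists (a, b).
  by rewrite /enters bi !inE /= [(a, b) \in _]ab aV bV xab.
(* The default [(s, s)] is never taken on [D], by [entry]. *)
pose g i := odflt (s, s) [pick e | enters i e].
have gP i : i \in D -> enters i (g i).
  move=> /entry[e ie]; rewrite /g; case: pickP => [//|none].
  by rewrite none in ie.
have g_inj : {in D &, injective g}.
  move=> i j iD jD gij; apply/eqP/negPn/negP => nij.
  have /andP[gC gi] := gP i iD; have /andP[_] := gP j jD; rewrite -gij => gj.
  move: iD jD; rewrite !inE => /andP[si /eqP yi] /andP[sj /eqP yj].
  (* The head of the entering arc lies in [V], so it is not [s], and used arcs have unique
     successors from there on. *)
  have gs : (g i).2 != s.
    apply: contraNneq snV => <-; move: gC.
    by rewrite !inE => /andP[/and3P[]].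
  have nc k l : k \in sigma -> l \in sigma -> k != l -> y k = 1 -> y l = 1 ->
      ~~ connect used k l.
    by move=> sk sl nkl; apply: conflict_not_connect; apply: clique.
  have := connect_functional (Q := fun k => k != s)
    used_out_inj used_neq_origin gs gi gj.
  rewrite (negPf (nc _ _ si sj nij yi yj)).
  by rewrite (negPf (nc _ _ sj si _ yj yi)) // eq_sym.
rewrite (binary_sum_card (D := sigma)) => [|i _]; last first.
  exact: feas_y_binary hfeas i.
rewrite (binary_sum_card (D := in_cut V)) => [|e]; last first.
  by rewrite inE => /andP[/(feas_x_binary hfeas)].
rewrite ler_nat -(card_in_imset g_inj); apply: subset_leq_card.
by apply/subsetP => _ /imsetP[i iD ->]; case/andP: (gP i iD).
Qed.

End Solution.

Theorem proposition1 (R : realType) (I : stop_instance R)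
    (hcycle : no_zero_time_cycle I)
    (x : vertex I * vertex I -> R) (y : vertex I -> R)
    (f : vertex I * vertex I -> R) (phi : R)
    (hfeas : feasible x y f phi)
    (sigma V : {set vertex I})
    (hsigma : conflict_clique sigma)
    (hV : V \subset ~: [set origin I])
    (hsigmaV : sigma \subset V) :
  \sum_(e in in_cut V) x e >= \sum_(i in sigma) y i.
Proof. exact: (clique_le_cut hfeas hcycle hsigma hV hsigmaV). Qed.
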